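(* Let $L$ be a locale and $S$ a sublocale of $L$. If $S$ is open, then $S\cap \mathrm{Rs}(L\ltimes S)$ is $S$-inaccessible, where $\mathrm{Rs}(L\ltimes S)=\bigvee\{A\in\mathcal{S}(L): A\text{ is remote from }S\}$. Moreover, if $S$ is dense and open, then $\mathfrak{B}L$ is $S$-inaccessible.
   Context: $\mathcal{S}(L)$ is the set of sublocales of $L$ ordered by inclusion; $\mathsf{O}=\{1\}$ is the void sublocale. $\overline{S}$ is the closure of $S$ in $L$; $S$ is dense if $\overline{S}=L$. $L\smallsetminus S$ is the supplement of $S$: the smallest $T\in\mathcal{S}(L)$ with $S\vee T=L$. $\mathfrak{B}L=\{x\to 0:x\in L\}$ is the Booleanization (smallest dense sublocale) of $L$. A sublocale $N$ of $L$ is nowhere dense if $N\cap\mathfrak{B}L=\mathsf{O}$; for $S\in\mathcal{S}(L)$, $N$ is $S$-nowhere dense if $N\subseteq S$ and $N$ is a nowhere dense sublocale of the locale $S$. A sublocale $A$ of $L$ is remote from $S$ if $A\cap\overline{N}=\mathsf{O}$ for every $S$-nowhere dense sublocale $N$ (closure in $L$). A sublocale $T\subseteq S$ is $S$-inaccessible if $T\cap\overline{N}=\mathsf{O}$ for every $(L\smallsetminus S)$-nowhere dense sublocale $N$ (closure in $L$). *)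

(* Defs.v *)
From HB Require Import structures.
From mathcomp Require Import all_boot all_order.
From mathcomp Require Import boolp classical_sets.

Set Implicit Arguments.
Unset Strict Implicit.
Unset Printing Implicit Defensive.

Import Order.TTheory.
Local Open Scope classical_set_scope.

(* A locale is treated through its frame of opens; the degenerate frame
   (\bot = \top) is allowed, since the void sublocale is a locale.  Finite
   distributivity is not assumed separately: it follows from [bigsup_meetr]. *)
HB.mixin Record isLocale d L of Order.TBLattice d L := {
  bigsup : set L -> L;
  bigsupP : forall A : set L, supremums A (bigsup A);
  bigsup_meetr : forall (a : L) (A : set L),
    (a `&` bigsup A)%O = bigsup [set (a `&` x)%O | x in A]
}.

#[short(type="localeType")]
HB.structure Definition Locale d := {L of Order.TBLattice d L & isLocale d L}.

Section LocaleTheory.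
Context {d : Order.disp_t} {L : localeType d}.
Implicit Types (x y z a b s : L) (A B : set L).

Definition biginf A : L := bigsup (lbound A).

Definition arrow x y : L := bigsup [set z | (z `&` x <= y)%O].

Lemma bigsup_le A y : (forall x, A x -> (x <= y)%O) -> (bigsup A <= y)%O.
Proof. by move=> h; apply: (bigsupP A).2 => x /h. Qed.

Lemma le_bigsup A x : A x -> (x <= bigsup A)%O.
Proof. exact: (bigsupP A).1. Qed.

Lemma biginf_le A x : A x -> (biginf A <= x)%O.
Proof. by move=> Ax; apply: bigsup_le => y; apply. Qed.

Lemma le_biginf A y : (forall x, A x -> (y <= x)%O) -> (y <= biginf A)%O.
Proof. by move=> h; apply: le_bigsup => x /h. Qed.

Lemma biginfP A : infimums A (biginf A).
Proof. by split=> [x /biginf_le | x h]; last exact: le_biginf. Qed.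

Lemma le_arrow z x y : (z <= arrow x y)%O = (z `&` x <= y)%O.
Proof.
apply/idP/idP => [h|h]; last exact: le_bigsup.
apply: (@le_trans _ _ (x `&` arrow x y)%O).
  by rewrite lexI leIr (le_trans _ h) ?leIl.
rewrite bigsup_meetr; apply: bigsup_le => _ [w /= hw <-].
by rewrite meetC.
Qed.

Lemma arrow_biginf x A :
  arrow x (biginf A) = biginf [set arrow x a | a in A].
Proof.
apply/le_anti/andP; split.
  apply: le_biginf => _ [a Aa <-]; rewrite le_arrow.
  by apply: le_trans (biginf_le Aa); rewrite -le_arrow.
rewrite le_arrow; apply: le_biginf => a Aa; rewrite -le_arrow.
by apply: biginf_le; exists a.
Qed.

Lemma arrow_arrow x y z : arrow x (arrow y z) = arrow (x `&` y)%O z.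
Proof.
apply/le_anti/andP; split; first by rewrite le_arrow meetA -!le_arrow.
by rewrite !le_arrow -meetA -le_arrow.
Qed.

Lemma le_arrow_self x y : (y <= arrow x y)%O.
Proof. by rewrite le_arrow leIl. Qed.

Lemma meet_arrow x y : (x `&` arrow x y)%O = (x `&` y)%O.
Proof.
apply/le_anti/andP; split; last exact: leI2 (lexx x) (le_arrow_self x y).
by rewrite lexI leIl /= meetC -le_arrow.
Qed.

Lemma arrow_meet x y : arrow x (x `&` y)%O = arrow x y.
Proof.
apply/le_anti/andP; split; rewrite le_arrow.
  by apply: le_trans (leIr y x); rewrite -le_arrow.
by rewrite lexI leIr -le_arrow lexx.
Qed.

End LocaleTheory.

Section Sublocales.
Context {d : Order.disp_t} (L : localeType d).

Definition is_sublocale (S : set L) : Prop :=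
  (forall A : set L, A `<=` S -> S (biginf A)) /\
  (forall x s : L, S s -> S (arrow x s)).

(* The order of S(L) is inclusion `<=` of the underlying sets. *)
Record sublocale := Sublocale {
  sublocale_set :> set L;
  sublocaleP : is_sublocale sublocale_set
}.

End Sublocales.

Lemma sublocale_inj {d : Order.disp_t} {L : localeType d} (S T : sublocale L) :
  S = T :> set L -> S = T.
Proof.
by case: S T => [S hS] [T hT] /= e; subst T; rewrite (Prop_irrelevance hS hT).
Qed.

(* A sublocale is itself a locale, for the order induced from L. *)
Section SublocaleAsLocale.
Context {d : Order.disp_t} {L : localeType d} (S : sublocale L).

Definition slcarrier : Type := {x : L | x \in (S : set L)}.

HB.instance Definition _ := SubType.on slcarrier.
HB.instance Definition _ := [Choice of slcarrier by <:].
HB.instance Definition _ := [SubChoice_isSubPOrder of slcarrier by <: with d].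

Implicit Types (x y : slcarrier).

Lemma slcarrierP x : sublocale_set S (val x).
Proof. exact: set_mem (valP x). Qed.

Definition sl_inf (A : set L) (AS : A `<=` S) : slcarrier :=
  exist _ (biginf A) (mem_set ((sublocaleP S).1 A AS)).

Lemma sl_ubounds_sub (A : set slcarrier) :
  (S : set L) `&` ubound [set val x | x in A] `<=` S.
Proof. by move=> x []. Qed.

Definition sl_bigsup (A : set slcarrier) : slcarrier :=
  sl_inf (@sl_ubounds_sub A).

Lemma sl_bigsupP (A : set slcarrier) : supremums A (sl_bigsup A).
Proof.
split=> [x Ax|y yub]; rewrite leEsub /=.
  by apply: le_biginf => z [_ /(_ (val x))]; apply; exists x.
apply: biginf_le; split; first exact: slcarrierP.
by move=> _ [x Ax <-]; exact: yub.
Qed.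

Lemma sl_meet_subproof x y : [set val x; val y] `<=` S.
Proof. by move=> _ [] ->; apply: slcarrierP. Qed.

Definition sl_meet x y : slcarrier := sl_inf (@sl_meet_subproof x y).
Definition sl_join x y : slcarrier := sl_bigsup [set x; y].

Lemma val_sl_meet x y : val (sl_meet x y) = (val x `&` val y)%O.
Proof.
apply/le_anti/andP; split; first by rewrite lexI !biginf_le //=; [right|left].
by apply: le_biginf => _ [] ->; rewrite ?leIl ?leIr.
Qed.

Lemma sl_lexI x y z : (x <= sl_meet y z)%O = (x <= y)%O && (x <= z)%O.
Proof. by rewrite !leEsub val_sl_meet lexI. Qed.

Lemma sl_leUx x y z : (sl_join x y <= z)%O = (x <= z)%O && (y <= z)%O.
Proof.
have [ub lub] := sl_bigsupP [set x; y].
apply/idP/andP => [h|[xz yz]]; last by apply: lub => _ [] ->.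
by split; apply: le_trans h; apply: ub; [left|right].
Qed.

Lemma sl_le0x x : (sl_bigsup set0 <= x)%O.
Proof. by apply: (sl_bigsupP set0).2. Qed.

Lemma sl_lex1 x : (x <= sl_bigsup setT)%O.
Proof. by apply: (sl_bigsupP setT).1. Qed.

HB.instance Definition _ :=
  Order.POrder_isMeetSemilattice.Build d slcarrier sl_lexI.
HB.instance Definition _ :=
  Order.POrder_isJoinSemilattice.Build d slcarrier sl_leUx.
HB.instance Definition _ := Order.hasBottom.Build d slcarrier sl_le0x.
HB.instance Definition _ := Order.hasTop.Build d slcarrier sl_lex1.

Lemma sl_bigsup_meetr (a : slcarrier) (A : set slcarrier) :
  (a `&` sl_bigsup A)%O = sl_bigsup [set (a `&` x)%O | x in A].
Proof.
have [ub lub] := sl_bigsupP A.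
have [ub' lub'] := sl_bigsupP [set (a `&` x)%O | x in A].
apply/le_anti/andP; split; last first.
  apply: lub' => _ [x Ax <-]; rewrite lexI leIl /=.
  by apply: le_trans (leIr _ _) (ub _ Ax).
set t := sl_bigsup [set _ | _ in _] in ub' lub' *.
pose r : slcarrier := exist _ (arrow (val a) (val t))
  (mem_set ((sublocaleP S).2 _ _ (slcarrierP t))).
have : (sl_bigsup A <= r)%O.
  apply: lub => x Ax; rewrite leEsub /= le_arrow.
  have : (sl_meet a x <= t)%O by apply: ub'; exists x.
  by rewrite leEsub val_sl_meet meetC.
rewrite (leEsub (sl_bigsup A) r) /= le_arrow meetC.
by rewrite -[(a `&` _)%O]/(sl_meet _ _) leEsub val_sl_meet.
Qed.

HB.instance Definition _ := isLocale.Build d slcarrier sl_bigsupP sl_bigsup_meetr.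

End SublocaleAsLocale.

Section SublocaleOps.
Context {d : Order.disp_t} {L : localeType d}.
Implicit Types (S T N A : sublocale L) (a : L) (F : set (sublocale L)).

(* The void sublocale O = {1}. *)
Lemma slvoid_subproof : is_sublocale [set \top%O : L].
Proof.
split=> [A AT|x s /= ->]; apply/le_anti; rewrite lex1 /=.
  by apply: le_biginf => x /AT ->.
exact: le_arrow_self.
Qed.
Definition slvoid : sublocale L := Sublocale slvoid_subproof.

Lemma slfull_subproof : is_sublocale [set: L].
Proof. by []. Qed.
Definition slfull : sublocale L := Sublocale slfull_subproof.

Lemma slclosed_subproof a : is_sublocale [set x : L | (a <= x)%O].
Proof.
split=> [A Aa|x s /= h]; first by apply: le_biginf => x /Aa.
exact: le_trans h (le_arrow_self _ _).
Qed.
Definition slclosed a : sublocale L := Sublocale (slclosed_subproof a).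

Lemma slopen_subproof a : is_sublocale [set arrow a x | x in [set: L]].
Proof.
split=> [A Aa|x _ [s _ <-]].
  exists (biginf A) => //; rewrite arrow_biginf; congr biginf.
  apply/seteqP; split=> x /=.
    move=> [y Ay <-]; have [z _ yz] := Aa y Ay.
    by rewrite -yz arrow_arrow meetxx yz.
  move=> Ax; exists x => //; have [z _ <-] := Aa x Ax.
  by rewrite arrow_arrow meetxx.
by exists (arrow x s) => //; rewrite !arrow_arrow meetC.
Qed.
Definition slopen a : sublocale L := Sublocale (slopen_subproof a).

Definition is_open S : Prop := exists a, S = slopen a.

(* Meets in S(L) are intersections. *)
Lemma slbigmeet_subproof F : is_sublocale [set x : L | forall S, F S -> sublocale_set S x].
Proof.
split=> [A AF S FS|x s h S FS].
  by apply: (sublocaleP S).1 => x /AF; apply.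
exact/(sublocaleP S).2/h.
Qed.
Definition slbigmeet F : sublocale L := Sublocale (slbigmeet_subproof F).

Lemma slmeet_subproof S T : is_sublocale ((S : set L) `&` (T : set L)).
Proof.
split=> [A AST|x s [hS hT]]; last by split; exact: (sublocaleP _).2.
by split; apply: (sublocaleP _).1 => x /AST [].
Qed.
Definition slmeet S T : sublocale L := Sublocale (slmeet_subproof S T).

(* Joins in S(L): the meets of subsets of the union; see [slbigjoin_lub]. *)
Lemma slbigjoin_subproof F :
  is_sublocale [set biginf M | M in [set M | M `<=` \bigcup_(S in F) (S : set L)]].
Proof.
set U := \bigcup_(S in F) _.
split=> [A AF|x _ [M MU <-]].
  exists [set x | U x /\ (biginf A <= x)%O]; first by move=> x [].
  apply/le_anti/andP; split; last by apply: le_biginf => x [].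
  apply: le_biginf => a Aa; have [M MU Ma] := AF a Aa.
  rewrite -Ma; apply: le_biginf => m Mm; apply: biginf_le; split; first exact: MU.
  by apply: le_trans (biginf_le Aa) _; rewrite -Ma; apply: biginf_le.
exists [set arrow x m | m in M]; last by rewrite arrow_biginf.
move=> _ [m /MU[S FS Sm] <-]; exists S => //; exact: (sublocaleP S).2.
Qed.
Definition slbigjoin F : sublocale L := Sublocale (slbigjoin_subproof F).
Definition sljoin S T : sublocale L := slbigjoin [set S; T].

Lemma slbigjoin_lub F :
  (forall S, F S -> (S : set L) `<=` slbigjoin F) /\
  (forall T, (forall S, F S -> (S : set L) `<=` T) ->
     (slbigjoin F : set L) `<=` T).
Proof.
split=> [S FS x Sx|T FT _ [M MU <-]].
  exists [set x]; first by move=> _ ->; exists S.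
  by apply/le_anti; rewrite biginf_le //= le_biginf // => _ ->.
by apply: (sublocaleP T).1 => m /MU[S /FT]; apply.
Qed.

(* The smallest closed sublocale containing S; see [slclosure_smallest]. *)
Definition slclosure S : sublocale L := slclosed (biginf (S : set L)).

Lemma slclosure_smallest S :
  (S : set L) `<=` slclosure S /\
  (forall a, (S : set L) `<=` slclosed a ->
     (slclosure S : set L) `<=` slclosed a).
Proof.
split=> [x Sx|a Sa x /= h]; first exact: biginf_le.
by apply: le_trans h; apply: le_biginf => y /Sa.
Qed.

Definition is_dense S : Prop := slclosure S = slfull.

(* The smallest T with S \/ T = L; see [supplement_smallest]. *)
Definition supplement S : sublocale L :=
  slbigmeet [set T | sljoin S T = slfull].

Lemma sljoinE S T (x : L) : sublocale_set (sljoin S T) x <->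
  exists s t, [/\ sublocale_set S s, sublocale_set T t & x = (s `&` t)%O].
Proof.
split=> [[M MU <-]|[s [t [Ss Tt ->]]]].
  exists (biginf (M `&` (S : set L))), (biginf (M `&` (T : set L))); split.
  - by apply: (sublocaleP S).1 => y [].
  - by apply: (sublocaleP T).1 => y [].
  apply/le_anti/andP; split.
    rewrite lexI; apply/andP.
    by split; apply: le_biginf => y [My _]; apply: biginf_le.
  apply: le_biginf => y My; have [_ [] -> ?] := MU y My.
    by apply: le_trans (leIl _ _) (biginf_le _).
  by apply: le_trans (leIr _ _) (biginf_le _).
exists [set s; t]; first by move=> _ [] ->; [exists S|exists T] => //; [left|right].
apply/le_anti/andP; split; first by rewrite lexI !biginf_le //=; [right|left].
by apply: le_biginf => _ [] ->; rewrite ?leIl ?leIr.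
Qed.

Lemma supplement_smallest S :
  sljoin S (supplement S) = slfull /\
  (forall T, sljoin S T = slfull -> (supplement S : set L) `<=` T).
Proof.
split; last by move=> T ST x; apply.
apply/sublocale_inj/seteqP; split=> // x _; apply/sljoinE.
pose s := biginf [set u | sublocale_set S u /\ (x <= u)%O].
have Ss : sublocale_set S s by apply: (sublocaleP S).1 => u [].
have xs : (x <= s)%O by apply: le_biginf => u [].
have key t u : sublocale_set S u -> x = (u `&` t)%O -> x = (s `&` t)%O.
  move=> Su e; apply/le_anti; rewrite lexI xs {1}e leIr /=.
  rewrite [leRHS]e lexI leIr andbT; apply: le_trans (leIl _ _) _.
  by apply: biginf_le; split => //; rewrite e leIl.
exists s, (arrow s x); split => //; last first.
  by rewrite meet_arrow; apply/esym/meet_r.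
move=> T /= ST; have : sublocale_set (sljoin S T) x by rewrite ST.
move=> /sljoinE[u [t [Su Tt /(key _ _ Su) e]]].
by rewrite e arrow_meet; exact: (sublocaleP T).2.
Qed.

End SublocaleOps.

Section NowhereDense.
Context {d : Order.disp_t}.

Lemma booleanization_subproof (L : localeType d) :
  is_sublocale [set arrow x (\bot%O : L) | x in [set: L]].
Proof.
split=> [A AB|x _ [y _ <-]]; last by exists (x `&` y)%O; rewrite ?arrow_arrow.
exists (bigsup [set x | A (arrow x \bot%O)]) => //.
apply/le_anti/andP; split.
  apply: le_biginf => y Ay; have [x _ xy] := AB y Ay; rewrite -xy.
  rewrite le_arrow (le_trans _ (_ : arrow (bigsup [set x | A (arrow x \bot%O)]) \bot%O
     `&` bigsup [set x | A (arrow x \bot%O)] <= _)%O) //.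
    by rewrite leI2 // le_bigsup //= xy.
  by rewrite -le_arrow.
rewrite le_arrow meetC -le_arrow; apply: bigsup_le => x Ax.
by rewrite le_arrow meetC -le_arrow biginf_le.
Qed.
Definition booleanization (L : localeType d) : sublocale L :=
  Sublocale (booleanization_subproof L).

Definition nowhere_dense (L : localeType d) (N : sublocale L) : Prop :=
  slmeet N (booleanization L) = slvoid.

Context {L : localeType d}.
Implicit Types (S T N A : sublocale L).

(* N is contained in S and, as a subset of the locale S, it is (the underlying
   set of) a nowhere dense sublocale of that locale. *)
Definition nowhere_dense_in S N : Prop :=
  exists2 N' : sublocale (slcarrier S),
    (N : set L) = [set val x | x in (N' : set (slcarrier S))] &
    nowhere_dense N'.

Definition remote_from S A : Prop :=
  forall N, nowhere_dense_in S N -> slmeet A (slclosure N) = slvoid.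

(* Rs(L |x S) *)
Definition Rs S : sublocale L := slbigjoin [set A | remote_from S A].

Definition inaccessible S T : Prop :=
  (T : set L) `<=` S /\
  forall N, nowhere_dense_in (supplement S) N ->
    slmeet T (slclosure N) = slvoid.

End NowhereDense.

(* Main.v *)
(* The supplement of the open sublocale S is closed, so it contains the closure
   of each of its sublocales N; hence that closure misses S, whether or not N is
   nowhere dense, and every sublocale of S is S-inaccessible.  If S is dense it
   contains 0, hence all x -> 0, i.e. the Booleanization. *)
Require Import Defs.
From mathcomp Require Import all_boot all_order.
From mathcomp Require Import boolp classical_sets.

Import Order.TTheory.
Local Open Scope classical_set_scope.

(** Each [x] is the meet of [arrow a x], in the open part, and the join of [a] and [x], in the
    closed part. *)
Lemma sljoin_slopen_slclosed (d : Order.disp_t) (L : localeType d) (a : L) :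
  sljoin (slopen a) (slclosed a) = slfull.
Proof.
apply/sublocale_inj/seteqP; split=> // x _; apply/sljoinE.
exists (arrow a x), (a `|` x)%O; split; [by exists x | exact: leUl |].
apply/le_anti; rewrite lexI le_arrow_self leUr /=.
(* By adjunction the join is bounded by [arrow (arrow a x) x], which is checked on [a] and [x]
   separately. *)
by rewrite meetC -le_arrow leUx !le_arrow meet_arrow leIr leIl.
Qed.

Lemma supplement_slopen_sub (d : Order.disp_t) (L : localeType d) (a : L) :
  (supplement (slopen a) : set L) `<=` slclosed a.
Proof. exact/(supplement_smallest _).2/sljoin_slopen_slclosed. Qed.

Lemma slmeet_slopen_slclosed (d : Order.disp_t) (L : localeType d) (a : L) :
  (slopen a : set L) `&` slclosed a `<=` [set \top%O].
Proof.
(* Having [a] below [arrow a y] already means [a <= y], and then [arrow a y] is the top. *)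
move=> _ [[y _ <-] /=]; rewrite le_arrow meetxx => ay.
by apply/le_anti; rewrite lex1 le_arrow meet1x ay.
Qed.

Lemma sublocale_top (d : Order.disp_t) (L : localeType d) (S : sublocale L) :
  sublocale_set S \top%O.
Proof.
have -> : \top%O = biginf (set0 : set L).
  by apply/le_anti; rewrite lex1 andbT; apply: le_biginf.
by apply: (sublocaleP S).1.
Qed.

Lemma nowhere_dense_in_sub (d : Order.disp_t) (L : localeType d)
    (S N : sublocale L) :
  nowhere_dense_in S N -> (N : set L) `<=` S.
Proof. by move=> [N' -> _] _ [x _ <-]; exact: slcarrierP. Qed.

Lemma inaccessible_sub_open (d : Order.disp_t) (L : localeType d)
    (S T : sublocale L) :
  is_open S -> (T : set L) `<=` S -> inaccessible S T.
Proof.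
move=> [a ->] TS; split=> // N /nowhere_dense_in_sub NS.
have clN : (slclosure N : set L) `<=` slclosed a.
  by apply: (slclosure_smallest N).2 => x /NS /supplement_slopen_sub.
apply/sublocale_inj/seteqP; split=> [x [/TS Sx /clN ax]|_ ->].
  by apply: (@slmeet_slopen_slclosed _ _ a); split.
by split; apply: sublocale_top.
Qed.

Lemma booleanization_sub_dense (d : Order.disp_t) (L : localeType d)
    (S : sublocale L) :
  is_dense S -> (booleanization L : set L) `<=` S.
Proof.
move=> dS _ [x _ <-]; apply: (sublocaleP S).2.
have : sublocale_set (slclosure S) \bot%O by rewrite dS.
(* The closure is the up-set of [biginf S]; it contains the bottom only if [biginf S], an element of
   [S], is the bottom. *)
rewrite /= lex0 => /eqP <-; exact: (sublocaleP S).1.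
Qed.

Theorem proposition5p5 (d : Order.disp_t) (L : localeType d) (S : sublocale L) :
  (is_open S -> inaccessible S (slmeet S (Rs S))) /\
  (is_dense S -> is_open S -> inaccessible S (booleanization L)).
Proof.
split=> [oS | dS oS]; apply: inaccessible_sub_open => //; first by move=> x [].
exact: booleanization_sub_dense.
Qed.
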